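(* Let $A$ be a commutative ring with unity with a semi-transition map $\psi:A\to\mathcal{P}(\Lambda)$, let $S=\{a\in A\mid\psi(a)=\emptyset\}$ and $A_S=S^{-1}A$. If $A$ is a pm-ring, then: (a) $A_S$ is also a pm-ring; (b) $\mathrm{Max}(A)$ is homeomorphic to $\mathrm{Max}(A_S)$.
   Context: All rings are commutative with unity. $\mathcal{P}(\Lambda)$ is the power set of $\Lambda$. For a ring $A$ and a nonempty set $\Lambda$, a map $\psi:A\to\mathcal{P}(\Lambda)$ is a semi-transition map on $A$ if: (i) $\psi(ab)=\psi(a)\cup\psi(b)$ for all $a,b\in A$; (ii) $\psi(1)=\emptyset$, and $\psi(a)=\Lambda$ if and only if $a=0$; (iii) for all $a,b\in A$ there is some $c$ in the ideal $(a,b)$ with $\psi(a)\cap\psi(b)=\psi(c)\subseteq\psi(a+b)$; moreover, if $\psi(a)\cap\psi(b)=\emptyset$, then the ideal $(a^m,b^n)$ is principal for some $m,n\in\mathbb{N}$ (positive integers). The set $S=\{a\in A\mid\psi(a)=\emptyset\}$ is multiplicatively closed. A pm-ring is a ring in which each prime ideal is contained in a unique maximal ideal. $\mathrm{Max}(R)$ is the set of maximal ideals of $R$ with the Zariski (hull-kernel) topology, whose basic closed sets are $\{M\in\mathrm{Max}(R)\mid a\in M\}$, $a\in R$. *)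

(* Defs.v *)
From HB Require Import structures.
From mathcomp Require Import all_boot all_algebra generic_quotient ring.
From mathcomp Require Import boolp classical_sets topology.

Set Implicit Arguments.
Unset Strict Implicit.
Unset Printing Implicit Defensive.
Import GRing.Theory.
Local Open Scope classical_set_scope.
Local Open Scope ring_scope.

(* Rings are [comPzRingType]s, i.e. the zero ring is allowed; MathComp's own
   ideal predicates are boolean and restricted to nontrivial rings. *)
Section Ideals.
Context {R : comPzRingType}.
Implicit Types I J P M : set R.

Definition is_ideal I : Prop :=
  [/\ I 0, forall x y, I x -> I y -> I (x + y) & forall a x, I x -> I (a * x)].

Definition is_prime P : Prop :=
  [/\ is_ideal P, P <> setT & forall a b, P (a * b) -> P a \/ P b].

Definition is_maximal M : Prop :=
  [/\ is_ideal M, M <> setT &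
      forall J, is_ideal J -> M `<=` J -> J = M \/ J = setT].

Definition ideal1 (a : R) : set R := [set x | exists u, x = u * a].

Definition ideal2 (a b : R) : set R := [set x | exists u v, x = u * a + v * b].

Definition is_principal I : Prop := exists d, I = ideal1 d.

Lemma is_maximal_prime M : is_maximal M -> is_prime M.
Proof.
move=> [[M0 MD MM] MT Mmax]; split=> // a b Mab.
have [Ma|nMa] := pselect (M a); [by left|right].
pose J := [set x : R | exists m u, M m /\ x = m + u * a].
have JI : is_ideal J.
  split; first by exists 0, 0; rewrite mul0r addr0.
    move=> _ _ [m [u [Mm ->]]] [n [v [Mn ->]]].
    by exists (m + n), (u + v); split; [exact: MD|rewrite mulrDl addrACA].
  move=> c _ [m [u [Mm ->]]]; exists (c * m), (c * u).
  by split; [exact: MM|rewrite mulrDr mulrA].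
have MJ : M `<=` J by move=> m Mm; exists m, 0; rewrite mul0r addr0.
have [JM|JT] := Mmax J JI MJ.
  by case: nMa; rewrite -JM; exists 0, 1; rewrite mul1r add0r.
have [m [u [Mm e1]]] : J 1 by rewrite JT.
rewrite -[b]mul1r e1 mulrDl -mulrA; apply: MD; last exact: MM.
by rewrite mulrC; exact: MM.
Qed.

Lemma is_maximalN1 M : is_maximal M -> ~ M 1.
Proof.
move=> [[_ _ MM] MT _] M1; apply: MT; rewrite -subTset => x _.
by rewrite -[x]mulr1; exact: MM.
Qed.

End Ideals.

Definition pm_ring (R : comPzRingType) : Prop :=
  forall P : set R, is_prime P -> exists! M, is_maximal M /\ P `<=` M.

Definition Max (R : comPzRingType) : Type := {M : set R | is_maximal M}.

Section MaxTopology.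
Variable R : comPzRingType.

HB.instance Definition _ := gen_eqMixin (Max R).
HB.instance Definition _ := gen_choiceMixin (Max R).

Definition Max_closed_basic (a : R) : set (Max R) := [set M | sval M a].

Let base : set (set (Max R)) :=
  [set U | exists a, U = ~` Max_closed_basic a].

Let base_cover : \bigcup_(U in base) U = setT.
Proof.
rewrite -subTset => M _; exists (~` Max_closed_basic 1); first by exists 1.
exact: is_maximalN1 (svalP M).
Qed.

Let base_join (U V : set (Max R)) (M : Max R) : base U -> base V -> U M -> V M ->
  exists W, [/\ base W, W M & W `<=` U `&` V].
Proof.
move=> [a ->] [b ->] Ma Mb; exists (~` Max_closed_basic (a * b)); split.
- by exists (a * b).
- by have [_ _ MP] := is_maximal_prime (svalP M); move=> /MP[].
- move=> N Nab; have [[_ _ NM] _ _] := svalP N.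
  by split=> Nx; apply: Nab; rewrite /Max_closed_basic/=; last exact: NM;
    rewrite mulrC; exact: NM.
Qed.

HB.instance Definition _ :=
  isBaseTopological.Build (Max R) base_cover base_join.

Lemma open_Max (U : set (Max R)) : open U <->
  exists E : set R, U = ~` \bigcap_(a in E) Max_closed_basic a.
Proof.
split.
- move=> [D' sD <-].
  exists [set a | D' (~` Max_closed_basic a)]; rewrite setC_bigcap.
  apply/seteqP; split=> [M [V DV VM]|M [a Da nM]].
    have [a e] := sD _ DV; exists a; rewrite /=; subst V => //.
  by exists (~` Max_closed_basic a).
- move=> [E ->]; rewrite setC_bigcap; apply: bigcup_open => a _.
  exists [set ~` Max_closed_basic a]; first by move=> _ ->; exists a.
  by rewrite bigcup_set1.
Qed.

End MaxTopology.

Definition homeomorphic (T U : topologicalType) : Prop :=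
  exists (f : T -> U) (g : U -> T),
    [/\ cancel f g, cancel g f, continuous f & continuous g].

Record mulset (R : comPzRingType) := MulSet {
  mset :> set R;
  mset1 : mset 1;
  msetM : forall a b, mset a -> mset b -> mset (a * b) }.

(* The ring of fractions S^-1 R: pairs (a, s) with s in S, where (a, s) and
   (b, t) are identified when u * (a * t - b * s) = 0 for some u in S. *)
Section Localization.
Variables (R : comPzRingType) (S : mulset R).
Local Open Scope quotient_scope.

Definition denom : Type := {s : R | s \in mset S}.
HB.instance Definition _ := Choice.on denom.

Lemma denomP (s : denom) : mset S (sval s).
Proof. exact: set_mem (svalP s). Qed.

Definition mkdenom (s : R) (Ss : mset S s) : denom := exist _ s (mem_set Ss).
Definition denom1 : denom := mkdenom (mset1 S).
Definition denomM (s t : denom) : denom := mkdenom (msetM (denomP s) (denomP t)).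

Definition fraction : Type := (R * denom)%type.
HB.instance Definition _ := Choice.on fraction.

Definition frac_equiv (x y : fraction) : bool :=
  `[< exists2 u, mset S u & u * (x.1 * sval y.2 - y.1 * sval x.2) = 0 >].

Lemma frac_equivP x y : reflect
  (exists2 u, mset S u & u * (x.1 * sval y.2 - y.1 * sval x.2) = 0)
  (frac_equiv x y).
Proof. exact: asboolP. Qed.

Lemma frac_equiv_is_equiv : equiv_class_of frac_equiv.
Proof.
have sym x y : frac_equiv x y -> frac_equiv y x.
  move=> /frac_equivP[u Su e]; apply/frac_equivP; exists u => //.
  by rewrite -opprB mulrN e oppr0.
split=> [x|x y|y x z].
- by apply/frac_equivP; exists 1; [exact: mset1|rewrite subrr mulr0].
- by apply/idP/idP; exact: sym.
- move=> /frac_equivP[u Su e] /frac_equivP[v Sv f]; apply/frac_equivP.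
  exists (u * v * sval y.2); first by do 2?apply: msetM => //; exact: denomP.
  have -> : u * v * sval y.2 * (x.1 * sval z.2 - z.1 * sval x.2) =
      v * sval z.2 * (u * (x.1 * sval y.2 - y.1 * sval x.2)) +
      u * sval x.2 * (v * (y.1 * sval z.2 - z.1 * sval y.2)) by ring.
  by rewrite e f !mulr0 addr0.
Qed.

Canonical frac_equiv_equiv := EquivRelPack frac_equiv_is_equiv.
Canonical frac_equiv_encModRel := defaultEncModRel frac_equiv.

Definition localization : Type := {eq_quot frac_equiv}.
HB.instance Definition _ := EqQuotient.on localization.
HB.instance Definition _ := Choice.on localization.

Definition frac_add (x y : fraction) : fraction :=
  (x.1 * sval y.2 + y.1 * sval x.2, denomM x.2 y.2).
Definition frac_opp (x : fraction) : fraction := (- x.1, x.2).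
Definition frac_mul (x y : fraction) : fraction := (x.1 * y.1, denomM x.2 y.2).

Definition loc0 : localization := lift_cst localization (0, denom1).
Definition loc1 : localization := lift_cst localization (1, denom1).
Definition loc_add := lift_op2 localization frac_add.
Definition loc_opp := lift_op1 localization frac_opp.
Definition loc_mul := lift_op2 localization frac_mul.

Lemma loc_eqP (x y : fraction) :
  (exists2 u, mset S u & u * (x.1 * sval y.2 - y.1 * sval x.2) = 0) <->
  \pi_localization x = \pi_localization y.
Proof.
by split=> [/frac_equivP e|e]; [apply/eqmodP|apply/frac_equivP/eqmodP].
Qed.

Canonical pi_loc0 := PiConst loc0.
Canonical pi_loc1 := PiConst loc1.

Let repr_equiv (x : fraction) (y := repr (\pi_localization x)) :
  exists2 u, mset S u & u * (x.1 * sval y.2 - y.1 * sval x.2) = 0.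
Proof. by apply/loc_eqP; rewrite reprK. Qed.

Lemma pi_loc_add : {morph \pi_localization : x y / frac_add x y >-> loc_add x y}.
Proof.
move=> x y; unlock loc_add.
have [u Su e] := repr_equiv x.
have [v Sv f] := repr_equiv y.
move: (repr (\pi_localization x)) (repr (\pi_localization y)) e f => x' y' e f.
apply/loc_eqP; exists (u * v) => /=; first exact: msetM.
rewrite [LHS](_ : _ =
    v * sval y.2 * sval y'.2 * (u * (x.1 * sval x'.2 - x'.1 * sval x.2)) +
    u * sval x.2 * sval x'.2 * (v * (y.1 * sval y'.2 - y'.1 * sval y.2))); last by ring.
by rewrite e f !mulr0 addr0.
Qed.
Canonical pi_loc_add_morph := PiMorph2 pi_loc_add.

Lemma pi_loc_opp : {morph \pi_localization : x / frac_opp x >-> loc_opp x}.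
Proof.
move=> x; unlock loc_opp.
have [u Su e] := repr_equiv x.
move: (repr (\pi_localization x)) e => x' e; apply/loc_eqP; exists u => //=.
by rewrite !mulNr -opprD mulrN e oppr0.
Qed.
Canonical pi_loc_opp_morph := PiMorph1 pi_loc_opp.

Lemma pi_loc_mul : {morph \pi_localization : x y / frac_mul x y >-> loc_mul x y}.
Proof.
move=> x y; unlock loc_mul.
have [u Su e] := repr_equiv x.
have [v Sv f] := repr_equiv y.
move: (repr (\pi_localization x)) (repr (\pi_localization y)) e f => x' y' e f.
apply/loc_eqP; exists (u * v) => /=; first exact: msetM.
rewrite [LHS](_ : _ =
    v * y.1 * sval y'.2 * (u * (x.1 * sval x'.2 - x'.1 * sval x.2)) +
    u * x'.1 * sval x.2 * (v * (y.1 * sval y'.2 - y'.1 * sval y.2))); last by ring.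
by rewrite e f !mulr0 addr0.
Qed.
Canonical pi_loc_mul_morph := PiMorph2 pi_loc_mul.

Let loc_eq1 (x y : fraction) : x.1 * sval y.2 = y.1 * sval x.2 ->
  \pi_localization x = \pi_localization y.
Proof.
by move=> e; apply/loc_eqP; exists 1; [exact: mset1|rewrite e subrr mulr0].
Qed.

Lemma loc_addA : associative loc_add.
Proof.
elim/quotW=> x; elim/quotW=> y; elim/quotW=> z; rewrite !piE.
by apply: loc_eq1 => /=; ring.
Qed.

Lemma loc_addC : commutative loc_add.
Proof.
elim/quotW=> x; elim/quotW=> y; rewrite !piE.
by apply: loc_eq1 => /=; ring.
Qed.

Lemma loc_add0 : left_id loc0 loc_add.
Proof. by elim/quotW=> x; rewrite !piE; apply: loc_eq1 => /=; ring. Qed.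

Lemma loc_addN : left_inverse loc0 loc_opp loc_add.
Proof. by elim/quotW=> x; rewrite !piE; apply: loc_eq1 => /=; ring. Qed.

HB.instance Definition _ :=
  GRing.isZmodule.Build localization loc_addA loc_addC loc_add0 loc_addN.

Lemma loc_mulA : associative loc_mul.
Proof.
elim/quotW=> x; elim/quotW=> y; elim/quotW=> z; rewrite !piE.
by apply: loc_eq1 => /=; ring.
Qed.

Lemma loc_mulC : commutative loc_mul.
Proof.
elim/quotW=> x; elim/quotW=> y; rewrite !piE.
by apply: loc_eq1 => /=; ring.
Qed.

Lemma loc_mul1 : left_id loc1 loc_mul.
Proof. by elim/quotW=> x; rewrite !piE; apply: loc_eq1 => /=; ring. Qed.

Lemma loc_mulDl : left_distributive loc_mul loc_add.
Proof.
elim/quotW=> x; elim/quotW=> y; elim/quotW=> z; rewrite !piE.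
by apply: loc_eq1 => /=; ring.
Qed.

HB.instance Definition _ := GRing.Zmodule_isComPzRing.Build localization
  loc_mulA loc_mulC loc_mul1 loc_mulDl.

End Localization.

Section SemiTransition.
Variables (A : comPzRingType) (Lambda : Type).

Definition semi_transition (psi : A -> set Lambda) : Prop :=
  [/\ forall a b, psi (a * b) = psi a `|` psi b,
      psi 1 = set0,
      forall a, psi a = setT <-> a = 0,
      forall a b, exists c,
        [/\ ideal2 a b c, psi a `&` psi b = psi c & psi c `<=` psi (a + b)] &
      forall a b, psi a `&` psi b = set0 ->
        exists m n : nat,
          [/\ (0 < m)%N, (0 < n)%N & is_principal (ideal2 (a ^+ m) (b ^+ n))]].

Variables (psi : A -> set Lambda) (psiP : semi_transition psi).

Let S1 : [set a | psi a = set0] 1. Proof. by case: psiP. Qed.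

Let SM a b : [set a | psi a = set0] a -> [set a | psi a = set0] b ->
  [set a | psi a = set0] (a * b).
Proof. by case: psiP => psiM _ _ _ _ /= a0 b0; rewrite psiM a0 b0 setU0. Qed.

Definition empty_mulset : mulset A := MulSet S1 SM.

End SemiTransition.

(* Main.v *)
(* Elements of S are nonzerodivisors. If (a, b) meets S, condition (iii) gives a
   principal ideal (a^m, b^n) = (d) with d in S, and dividing a^m and b^n by d
   produces comaximal elements of A. Hence the embedding phi of A into A_S lifts
   comaximality: if z1 + z2 = 1 in A_S, there are x + y = 1 in A with phi x in
   (z1) and phi y in (z2). For any injective phi : A -> L with this property and
   any pm-ring A, distinct maximal ideals of L contract into distinct maximal
   ideals of A, so L is a pm-ring and "the maximal ideal above the contraction"
   is an injection of Max L into Max A. Its surjectivity and continuity come from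
   Contessa's identity: in a pm-ring, a + b = 1 implies (1 - a r) (1 - b s) = 0
   for some r and s; the continuity of its inverse is again the lifting. *)
Require Import Defs.
From HB Require Import structures.
From mathcomp Require Import all_boot all_algebra generic_quotient ring.
From mathcomp Require Import boolp classical_sets topology.

Set Implicit Arguments.
Unset Strict Implicit.
Unset Printing Implicit Defensive.
Import GRing.Theory.
Local Open Scope classical_set_scope.
Local Open Scope ring_scope.

(** * Comaximal elements, and maximal and prime ideals from Zorn's lemma *)

Section Ideals.
Context {R : comPzRingType}.
Implicit Types (I J P M T : set R) (a b : R).

Definition idealU1 I a : set R := [set x | exists i u, I i /\ x = i + u * a].

Lemma idealU1_ideal I a : is_ideal I -> is_ideal (idealU1 I a).
Proof.
move=> [I0 ID IM]; split; first by exists 0, 0; rewrite mul0r addr0.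
  move=> _ _ [i [u [Ii ->]]] [j [v [Ij ->]]].
  by exists (i + j), (u + v); split; [exact: ID|ring].
move=> c _ [i [u [Ii ->]]]; exists (c * i), (c * u).
by split; [exact: IM|ring].
Qed.

Lemma idealU1_sub I a : I `<=` idealU1 I a.
Proof. by move=> x Ix; exists x, 0; rewrite mul0r addr0. Qed.

Lemma idealU1_mem I a : is_ideal I -> idealU1 I a a.
Proof. by move=> [I0 _ _]; exists 0, 1; rewrite mul1r add0r. Qed.

Lemma is_idealN1 I : is_ideal I -> I <> setT -> ~ I 1.
Proof.
move=> [_ _ IM] IT I1; apply: IT; rewrite -subTset => x _.
by rewrite -[x]mulr1; exact: IM.
Qed.

Lemma is_ideal_mulr I a b : is_ideal I -> I a -> I (a * b).
Proof. by move=> [_ _ IM] Ia; rewrite mulrC; exact: IM. Qed.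

Lemma is_maximal_comax M a : is_maximal M -> ~ M a ->
  exists m u, M m /\ m + u * a = 1.
Proof.
move=> [MI MT Mmax] nMa.
have [eM|eT] := Mmax _ (idealU1_ideal a MI) (@idealU1_sub M a).
  by case: nMa; rewrite -eM; exact: idealU1_mem.
have [m [u [Mm e]]] : idealU1 M a 1 by rewrite eT.
by exists m, u.
Qed.

Lemma is_maximal_exN M N : is_maximal M -> is_maximal N -> M <> N ->
  exists2 a, M a & ~ N a.
Proof.
move=> [_ _ Mmax] [NI NT _] MN; apply: contrapT => h.
have MsN : M `<=` N.
  by move=> a Ma; apply: contrapT => nNa; apply: h; exists a.
by case: (Mmax N NI MsN) => // eNM; apply: MN; rewrite eNM.
Qed.

(** [T] is an arbitrary set so that one appeal to Zorn serves twice: [T] = {1} gives maximal ideals,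
    a multiplicative [T] gives primes. *)
Lemma ideal_maximal_disjoint I T : is_ideal I -> I `&` T = set0 ->
  exists P, [/\ is_ideal P, I `<=` P, P `&` T = set0 &
    forall J, is_ideal J -> P `<=` J -> J `&` T = set0 -> J = P].
Proof.
move=> II IT.
pose good J := [/\ is_ideal J, I `<=` J & J `&` T = set0].
have gI : good I by split.
(* [Zorn_bigcup] also asks for the union of the empty chain. *)
have [F Fgood Ftot|P [[P0|[PI IP PT]] Pmax]] :=
    @Zorn_bigcup R [set J | J = set0 \/ good J].
- have [Fne|Fe] := pselect (exists2 J, F J & good J); last first.
    left; rewrite -subset0 => x [J FJ Jx].
    by case: (Fgood _ FJ) => [J0|gJ]; [rewrite J0 in Jx|apply: Fe; exists J].
  have gF J x : F J -> J x -> good J.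
    by move=> /Fgood[J0|//] Jx; rewrite J0 in Jx.
  right; have [J FJ [[J0 _ _] IJ _]] := Fne.
  split; first 1 last.
  + by move=> x Ix; exists J => //; exact: IJ.
  + rewrite -subset0 => x [[K FK Kx] Tx].
    by have [_ _ KT] := gF _ _ FK Kx; rewrite -KT.
  + split; first by exists J.
    * move=> x y [K FK Kx] [H FH Hy].
      have [[_ KD _] _ _] := gF _ _ FK Kx.
      have [[_ HD _] _ _] := gF _ _ FH Hy.
      case: (Ftot _ _ FK FH) => [KH|HK].
        by exists H => //; apply: HD => //; exact: KH.
      by exists K => //; apply: KD => //; exact: HK.
    * move=> a x [K FK Kx]; have [[_ _ KM] _ _] := gF _ _ FK Kx.
      by exists K => //; exact: KM.
(* The empty set is not a maximal element, since [I] strictly contains it. *)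
- case: (Pmax I); last by right.
  by rewrite P0 properEneq; split=> //; apply/eqP => e; case: II => I0; rewrite -e in I0.
- exists P; split=> // J JI PJ JT; apply: contrapT => JP.
  case: (Pmax J); last by right; split=> //; exact: subset_trans PJ.
  by rewrite properEneq; split=> //; apply/eqP => e; exact: JP.
Qed.

Lemma maximal_above I : is_ideal I -> ~ I 1 ->
  exists M, is_maximal M /\ I `<=` M.
Proof.
move=> II I1.
have [|M [MI IM M1 Mmax]] := @ideal_maximal_disjoint I [set 1] II.
  by rewrite -subset0 => x [Ix /= x1]; apply: I1; rewrite -x1.
exists M; split=> //; split=> //.
  by move=> MT; rewrite MT setTI in M1; have : set0 (1 : R) by rewrite -M1.
move=> J JI MJ; have [J1|nJ1] := pselect (J 1).
  right; rewrite -subTset => x _; case: JI => _ _ JM.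
  by rewrite -[x]mulr1; exact: JM.
left; apply: Mmax => //.
by rewrite -subset0 => x [Jx /= x1]; apply: nJ1; rewrite -x1.
Qed.

Lemma prime_disjoint (T : mulset R) : ~ mset T 0 ->
  exists2 P, is_prime P & P `&` T = set0.
Proof.
move=> T0.
have I0 : is_ideal [set (0 : R)].
  by split=> //= [x y -> ->|a x ->]; rewrite ?addr0 ?mulr0.
have [|P [PI _ PT Pmax]] := @ideal_maximal_disjoint [set 0] T I0.
  by rewrite -subset0 => x [/= -> ].
have nPT x : P x -> mset T x -> False by move=> Px Tx; have : set0 x by rewrite -PT.
have meet a : ~ P a -> exists p u, P p /\ mset T (p + u * a).
  move=> nPa; apply: contrapT => h; apply: nPa.
  rewrite -(Pmax _ (idealU1_ideal a PI) (@idealU1_sub P a)).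
    exact: idealU1_mem.
  rewrite -subset0 => _ [[p [u [Pp ->]]] Tpu]; apply: h.
  by exists p, u.
exists P => //; split=> //.
  by move=> PT'; apply: (nPT 1); [rewrite PT'|exact: mset1].
(* If [a] and [b] lie outside [P], then P + (a) and P + (b) both meet [T]; the product of the two
   elements found lies in [T], and in [P] because [a * b] does. *)
move=> a b Pab; apply: contrapT => /not_orP[/meet[p [u [Pp Tp]]]].
move=> /meet[q [v [Pq Tq]]]; apply: (nPT _ _ (msetM Tp Tq)).
have -> : (p + u * a) * (q + v * b) =
    p * (q + v * b) + (q * (u * a) + (a * b) * (u * v)) by ring.
case: (PI) => _ PD _.
by apply: (PD); [exact: is_ideal_mulr|apply: PD; exact: is_ideal_mulr].
Qed.

End Ideals.

(** The products (1 - a r)(1 - b s) form a multiplicative set [T]. If 0 is not in [T], some prime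
    [P] avoids [T]. Then P + (a) and P + (b) are proper, as p + u a = 1 would put p = 1 - a u in
    [T]. The maximal ideals above them both contain [P], so they coincide and contain a + b = 1. *)
Lemma pm_ring_identity (R : comPzRingType) (a b : R) : pm_ring R ->
  a + b = 1 -> exists r s, (1 - a * r) * (1 - b * s) = 0.
Proof.
move=> R_pm ab1.
pose T : set R := [set x | exists r s, x = (1 - a * r) * (1 - b * s)].
have T1 : T 1 by exists 0, 0; ring.
have TM x y : T x -> T y -> T (x * y).
  move=> [r [s ->]] [r' [s' ->]].
  by exists (r + r' - a * r * r'), (s + s' - b * s * s'); ring.
have [[r [s e]]|T0] := pselect (T 0); first by exists r, s; rewrite -e.
have [P Pp PT] := @prime_disjoint R (MulSet T1 TM) T0.
have [PI _ _] := Pp.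
have above c : (forall r, T (1 - c * r)) ->
    exists M, [/\ is_maximal M, P `<=` M & M c].
  move=> Tc; have [|M [MM PM]] := maximal_above (idealU1_ideal c PI).
    move=> [p [u [Pp' e]]]; have : set0 p.
      rewrite -PT; split=> //=.
      by rewrite [p](_ : _ = 1 - c * u); [exact: Tc|rewrite e; ring].
    by [].
  exists M; split=> //; first exact: subset_trans (@idealU1_sub _ P c) PM.
  by apply: PM; exact: idealU1_mem.
have [r|M [MM PM Ma]] := above a; first by exists r, 0; ring.
have [s|N [NM PN Nb]] := above b; first by exists 0, s; ring.
have [K [_ Kuniq]] := R_pm P Pp.
have MN : M = N by rewrite -(Kuniq M) // -(Kuniq N).
have [[_ MD _] _ _] := MM.
case: (is_maximalN1 MM); rewrite -ab1; apply: MD => //.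
by rewrite MN.
Qed.

(** * Points and continuity in the maximal spectrum *)

Lemma Max_eq (R : comPzRingType) (M N : Max R) : sval M = sval N -> M = N.
Proof. by case: M N => [M MM] [N NM] /= e; exact: eq_exist. Qed.

Lemma continuous_Max (T : topologicalType) (R : comPzRingType) (f : T -> Max R) :
  (forall a, open [set x | ~ sval (f x) a]) -> continuous f.
Proof.
move=> fo; apply/continuousP => U /open_Max[E ->].
rewrite setC_bigcap preimage_bigcup; apply: bigcup_open => a _.
exact: fo.
Qed.

Lemma open_MaxN (R : comPzRingType) (a : R) :
  open [set M : Max R | ~ sval M a].
Proof. by apply/open_Max; exists [set a]; rewrite bigcap_set1. Qed.

(** * Maximal ideals along a morphism that lifts comaximality *)

Section ComaximalLifting.
Variables (A L : comPzRingType) (phi : {rmorphism A -> L}).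

Definition lifts_comaximality : Prop :=
  forall z1 z2 : L, z1 + z2 = 1 ->
  exists x y, [/\ x + y = 1, ideal1 z1 (phi x) & ideal1 z2 (phi y)].

Hypotheses (A_pm : pm_ring A) (phi_inj : injective phi).
Hypothesis phi_comax : lifts_comaximality.

Lemma preimage_prime (Q : set L) : is_prime Q -> is_prime (phi @^-1` Q).
Proof.
move=> [QI QT Qp]; have [Q0 QD QM] := QI; split.
- split=> [|x y Qx Qy|a x Qx]; rewrite /preimage/=.
  + by rewrite rmorph0.
  + by rewrite rmorphD; exact: QD.
  + by rewrite rmorphM; exact: QM.
- move=> e; apply: (is_idealN1 QI QT); rewrite -(rmorph1 phi).
  by have : setT (1 : A) by []; rewrite -e.
- by move=> a b; rewrite /preimage/= rmorphM; exact: Qp.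
Qed.

(** Distinct maximal ideals are comaximal. Lifting q + u a = 1, with [q] in [Q2] and [a] in [Q1],
    gives x + y = 1 with both [x] and [y] in [M]. *)
Lemma preimage_maximal_inj (Q1 Q2 : set L) (M : set A) :
  is_maximal Q1 -> is_maximal Q2 -> is_maximal M ->
  phi @^-1` Q1 `<=` M -> phi @^-1` Q2 `<=` M -> Q1 = Q2.
Proof.
move=> mQ1 mQ2 mM Q1M Q2M; apply: contrapT => Q12.
have [a Q1a nQ2a] := is_maximal_exN mQ1 mQ2 Q12.
have [q [u [Q2q qu1]]] := is_maximal_comax mQ2 nQ2a.
have [x [y [xy1 [w wx] [v vy]]]] := phi_comax qu1.
have [[_ _ Q1I] _ _] := mQ1; have [[_ _ Q2I] _ _] := mQ2.
have [[_ MD _] _ _] := mM.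
case: (is_maximalN1 mM); rewrite -xy1; apply: MD.
  by apply: Q2M; rewrite /preimage/= wx; exact: Q2I.
by apply: Q1M; rewrite /preimage/= vy; do 2!apply: (Q1I).
Qed.

Lemma preimage_maximal_above (Q : set L) : is_maximal Q ->
  exists! M, is_maximal M /\ phi @^-1` Q `<=` M.
Proof. by move=> /is_maximal_prime/preimage_prime/A_pm. Qed.

Lemma lifting_pm_ring : pm_ring L.
Proof.
move=> P Pp; have [PI PT _] := Pp.
have [Q [mQ PQ]] := maximal_above PI (is_idealN1 PI PT).
exists Q; split=> // Q' [mQ' PQ'].
have [M [[mM QM] _]] := preimage_maximal_above mQ.
have [M' [[mM' QM'] _]] := preimage_maximal_above mQ'.
have [N [_ Nuniq]] := A_pm (preimage_prime Pp).
have MN : N = M by apply: Nuniq; split=> // x /PQ; exact: QM.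
have MN' : N = M' by apply: Nuniq; split=> // x /PQ'; exact: QM'.
by apply: (preimage_maximal_inj mQ mQ' mM) => //; rewrite -MN MN'.
Qed.

(* The elements of A killed by an element outside M all lie in every prime below
   M; as A is a pm-ring, M is the only maximal ideal containing them. *)
Lemma maximal_lies_below (M : set A) : is_maximal M ->
  exists Q, is_maximal Q /\ phi @^-1` Q `<=` M.
Proof.
move=> mM; have [[M0 MD MI] MT _] := mM.
have [_ _ Mp] := is_maximal_prime mM.
pose J : set L := [set z | exists t, ~ M t /\ phi t * z = 0].
have JI : is_ideal J.
  split; first by exists 1; rewrite mulr0; split=> //; exact: is_maximalN1.
    move=> x y [t [Mt tx]] [u [Mu uy]]; exists (t * u); split.
      by move=> /Mp[].
    have -> : phi (t * u) * (x + y) = phi u * (phi t * x) + phi t * (phi u * y).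
      by rewrite rmorphM; ring.
    by rewrite tx uy !mulr0 addr0.
  by move=> a x [t [Mt tx]]; exists t; rewrite mulrCA tx mulr0.
(* [J] is proper by injectivity: if [phi t] kills 1, then t = 0, which lies in [M]. *)
have [|Q [mQ JQ]] := maximal_above JI.
  move=> [t [Mt]]; rewrite mulr1 => /eqP.
  by rewrite -(rmorph0 phi) => /eqP/phi_inj t0; apply: Mt; rewrite t0.
have [N [[mN QN] _]] := preimage_maximal_above mQ.
exists Q; split=> //.
suff -> : M = N by [].
(* With n + u a = 1 for [n] in [N] and [a] in [M], the factor 1 - u a s is outside [M] and kills 1 -
   n r. So [phi (1 - n * r)] is in [J], hence in [Q], which forces 1 into [N]. *)
apply: contrapT => MN; have [a Ma nNa] := is_maximal_exN mM mN MN.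
have [n [u [Nn nu1]]] := is_maximal_comax mN nNa.
have [r [s rs0]] := pm_ring_identity A_pm nu1.
have [[_ ND NI] _ _] := mN.
have nMua : ~ M (1 - u * a * s).
  move=> h; apply: (is_maximalN1 mM).
  have -> : 1 = (1 - u * a * s) + s * (u * a) by ring.
  by apply: MD => //; do 2!apply: (MI).
have N1 : N (1 - n * r).
  apply: QN; apply: JQ; exists (1 - u * a * s); split=> //.
  by rewrite mulrC -rmorphM rs0 rmorph0.
apply: (is_maximalN1 mN); have -> : 1 = (1 - n * r) + r * n by ring.
by apply: ND => //; exact: NI.
Qed.

Lemma lifting_homeomorphic : homeomorphic (Max A) (Max L).
Proof.
have [Q|mu muP] := @choice (Max L) (Max A)
    (fun Q M => phi @^-1` sval Q `<=` sval M).
  have [M [[mM QM] _]] := preimage_maximal_above (svalP Q).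
  by exists (exist _ M mM).
have [M|nu nuP] := @choice (Max A) (Max L)
    (fun M Q => phi @^-1` sval Q `<=` sval M).
  have [Q [mQ QM]] := maximal_lies_below (svalP M).
  by exists (exist _ Q mQ).
have nuK : cancel nu mu.
  move=> M; have [N [_ Nuniq]] := preimage_maximal_above (svalP (nu M)).
  apply: Max_eq; rewrite -(Nuniq (sval M)); last by split; [exact: svalP|exact: nuP].
  by rewrite -(Nuniq (sval (mu (nu M)))) //; split; [exact: svalP|exact: muP].
have muK : cancel mu nu.
  move=> Q; apply: Max_eq.
  by apply: preimage_maximal_inj (svalP _) (svalP _) (svalP (mu Q)) _ _;
    [exact: nuP|exact: muP].
exists nu, mu; split=> //; apply: continuous_Max => z.
(* Continuity of [nu]: q + u z = 1 with [q] in [nu M] lifts to x + y = 1. Then [y] is not in [M],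
   and any [N] avoiding [y] has [z] outside [nu N]. *)
- rewrite openE => M /= nz; rewrite /interior nbhsE.
  have [q [u [Qq qu1]]] := is_maximal_comax (svalP (nu M)) nz.
  have [x [y [xy1 [w wx] [v vy]]]] := phi_comax qu1.
  have [[_ MD _] _ _] := svalP M.
  have [[_ _ QI] _ _] := svalP (nu M).
  exists [set N | ~ sval N y].
    split; first exact: open_MaxN.
    move=> /= My; apply: (is_maximalN1 (svalP M)); rewrite -xy1; apply: MD => //.
    by apply: nuP; rewrite /preimage/= wx; exact: QI.
  move=> N /= Ny Nz; apply: Ny; apply: nuP; rewrite /preimage/= vy.
  by have [[_ _ NI] _ _] := svalP (nu N); do 2!apply: (NI).
(* Continuity of [mu]: a prime of [L] that avoids [phi (1 - m * r)] must contain
   [phi (1 - u * z * s)], and this keeps [z] out of its image under [mu]. *)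
- rewrite openE => Q /= nz; rewrite /interior nbhsE.
  have [m [u [Mm mu1]]] := is_maximal_comax (svalP (mu Q)) nz.
  have [r [s rs0]] := pm_ring_identity A_pm mu1.
  have [[_ MD MI] _ _] := svalP (mu Q).
  exists [set P | ~ sval P (phi (1 - m * r))].
    split; first exact: open_MaxN.
    move=> /= /muP h; apply: (is_maximalN1 (svalP (mu Q))).
    have -> : 1 = (1 - m * r) + r * m by ring.
    by apply: MD => //; exact: MI.
  move=> P /= Pn Pz.
  have [[P0 _ _] _ Pp] := is_maximal_prime (svalP P).
  have [//|/muP h] : sval P (phi (1 - m * r)) \/ sval P (phi (1 - u * z * s)).
    by apply: Pp; rewrite -rmorphM rs0 rmorph0.
  have [[_ ND NI] _ _] := svalP (mu P).
  apply: (is_maximalN1 (svalP (mu P))).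
  have -> : 1 = (1 - u * z * s) + s * (u * z) by ring.
  by apply: ND => //; do 2!apply: (NI).
Qed.

End ComaximalLifting.

(** * The canonical map to the ring of fractions *)

Section LocalizationMap.
Variables (R : comPzRingType) (S : mulset R).
Local Open Scope quotient_scope.

Definition loc_map (a : R) : localization S := \pi_(localization S) (a, denom1 S).

Lemma loc_map_zmod_morphism : zmod_morphism loc_map.
Proof.
move=> a b; rewrite /loc_map.
(* Restating the ring operations as the raw quotient operations lets [piE] compute on
   representatives. *)
have -> : \pi_(localization S) (a, denom1 S) - \pi_(localization S) (b, denom1 S) =
  loc_add (\pi_(localization S) (a, denom1 S)) (loc_opp (\pi_(localization S) (b, denom1 S))) by [].
rewrite !piE; apply/loc_eqP; exists 1; first exact: mset1.
by rewrite /=; ring.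
Qed.

Lemma loc_map_monoid_morphism : monoid_morphism loc_map.
Proof.
split; first by rewrite /loc_map -[RHS]/(loc1 S) !piE.
move=> a b; rewrite /loc_map -[RHS]/(loc_mul _ _) !piE.
by apply/loc_eqP; exists 1; [exact: mset1|rewrite /=; ring].
Qed.

HB.instance Definition _ :=
  GRing.isZmodMorphism.Build R (localization S) loc_map loc_map_zmod_morphism.
HB.instance Definition _ :=
  GRing.isMonoidMorphism.Build R (localization S) loc_map loc_map_monoid_morphism.

Lemma loc_map_inj : (forall s a, mset S s -> s * a = 0 -> a = 0) ->
  injective loc_map.
Proof.
move=> Sreg a b /loc_eqP[u Su] /= /(Sreg _ _ Su) e.
by apply/subr0_eq; rewrite -e; ring.
Qed.

(** The cofactor is explicit: x/1 = (c s/d)(a/s). *)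
Lemma ideal1_loc_map (a x c : R) (s : denom S) (d : R) : mset S d ->
  d * x = c * a -> ideal1 (\pi_(localization S) (a, s)) (loc_map x).
Proof.
move=> Sd e; exists (\pi_(localization S) (c * sval s, mkdenom Sd)).
rewrite /loc_map -[RHS]/(loc_mul _ _) !piE.
apply/loc_eqP; exists 1; first exact: mset1.
rewrite [LHS](_ : _ = sval s * (d * x - c * a)); last by rewrite /=; ring.
by rewrite e subrr mulr0.
Qed.

End LocalizationMap.

(** * Comaximality in the localization at a semi-transition map *)

Section SemiTransitionLocalization.
Variables (A : comPzRingType) (Lambda : Type) (psi : A -> set Lambda).
Hypothesis psiP : semi_transition psi.

Lemma semi_transition_regular (s a : A) : psi s = set0 -> s * a = 0 -> a = 0.
Proof.
case: psiP => psiM _ psi0 _ _ s0 sa0; apply/psi0.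
by rewrite -[psi a]set0U -s0 -psiM sa0; apply/psi0.
Qed.

Lemma semi_transition_exp (a : A) n : (0 < n)%N -> psi (a ^+ n) = psi a.
Proof.
case: psiP => psiM _ _ _ _.
case: n => // n _; elim: n => [|n IH]; first by rewrite expr1.
by rewrite exprS psiM IH setUid.
Qed.

(** Condition (iii) makes [psi a] and [psi b] disjoint, hence (a^m, b^n) = (d) for some positive
    exponents, written as successors so that a factor [a] or [b] can be split off later. Cancelling
    the regular [d] in d = u a^m + v b^n leaves comaximal quotients. *)
Lemma semi_transition_comax (a b : A) : psi (a + b) = set0 ->
  exists d x y m n, [/\ psi d = set0, a ^+ m.+1 = d * x, b ^+ n.+1 = d * y &
    exists u v, u * x + v * y = 1].
Proof.
case: (psiP) => psiM _ _ psiI psi_principal ab0.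
have psiab : psi a `&` psi b = set0.
  by have [c [_ -> ]] := psiI a b; rewrite ab0 subset0.
have [m' [n' [m0 n0 [d]]]] := psi_principal _ _ psiab.
case: m' n' m0 n0 => [//|m] [//|n] _ _ dE.
have mem z : ideal2 (a ^+ m.+1) (b ^+ n.+1) z -> exists w, z = w * d.
  by rewrite dE.
have [x ax] : exists x, a ^+ m.+1 = x * d by apply: mem; exists 1, 0; ring.
have [y bdy] : exists y, b ^+ n.+1 = y * d by apply: mem; exists 0, 1; ring.
have [u [v duv]] : ideal2 (a ^+ m.+1) (b ^+ n.+1) d.
  by rewrite dE; exists 1; rewrite mul1r.
have d0 : psi d = set0.
  (* Condition (iii) for the powers gives [c] in (d) with empty [psi c]; as [c] is a multiple of
     [d], [psi d] is contained in [psi c]. *)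
  have [c [/mem[w cw] cE _]] := psiI (a ^+ m.+1) (b ^+ n.+1).
  rewrite !semi_transition_exp // psiab cw psiM in cE.
  by rewrite -subset0 cE; exact: subsetUr.
exists d, x, y, m, n; split=> //; try by rewrite mulrC.
exists u, v; apply/eqP; rewrite -subr_eq0; apply/eqP.
apply: (semi_transition_regular d0); rewrite mulrBr mulr1 {2}duv ax bdy.
by ring.
Qed.

Lemma loc_map_comax : lifts_comaximality (@loc_map A (empty_mulset psiP)).
Proof.
elim/quotW => -[a1 s1]; elim/quotW => -[a2 s2].
rewrite -[LHS]/(loc_add _ _) -[RHS]/(loc1 _) !piE => /loc_eqP[w w0 /=].
move=> /(semi_transition_regular w0) e.
(* Clearing denominators in a1/s1 + a2/s2 = 1 gives a sum lying in S. *)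
have {}e : a1 * sval s2 + a2 * sval s1 = sval s1 * sval s2.
  by apply/subr0_eq; rewrite -e; ring.
have [|d [x [y [m [n [d0 ax bdy [u [v uv1]]]]]]]] :=
    @semi_transition_comax (a1 * sval s2) (a2 * sval s1).
  by rewrite e; exact: (msetM (denomP s1) (denomP s2)).
exists (u * x), (v * y); split=> //.
(* d u x = u (a1 s2)^(m+1); splitting off one factor [a1] gives the coefficient. *)
- apply: (@ideal1_loc_map _ _ _ _ (u * sval s2 * (a1 * sval s2) ^+ m) _ d) => //.
  by rewrite mulrCA -ax exprS; ring.
- apply: (@ideal1_loc_map _ _ _ _ (v * sval s1 * (a2 * sval s1) ^+ n) _ d) => //.
  by rewrite mulrCA -bdy exprS; ring.
Qed.

End SemiTransitionLocalization.

Theorem theorem2p6 (A : comPzRingType) (Lambda : Type)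
    (Lambda_neq0 : [set: Lambda] !=set0) (psi : A -> set Lambda)
    (psiP : semi_transition psi) (A_pm : pm_ring A) :
  pm_ring (localization (empty_mulset psiP)) /\
  homeomorphic (Max A) (Max (localization (empty_mulset psiP))).
Proof.
have inj : injective (@loc_map A (empty_mulset psiP)).
  by apply: loc_map_inj => s a; exact: semi_transition_regular.
split; first exact: lifting_pm_ring A_pm (@loc_map_comax _ _ _ psiP).
exact: lifting_homeomorphic A_pm inj (@loc_map_comax _ _ _ psiP).
Qed.
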